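(* Let $\Gamma$ be a sub-exponential relational structure with domain $D$, automorphism group $G$ and (finitely many) orbits $U_1,\dots,U_k$, and for $1\le i\le k$ let $G_i=\{\alpha|_{U_i}\mid\alpha\in G\}$ be the transitive constituent of $G$ on $U_i$. Assume that each $G_i$ is isomorphic (as a permutation group) to $\mathrm{Aut}((\mathbb{Q};<))$. Then a permutation $\alpha$ of $D$ is an automorphism of $\Gamma$ if and only if $\alpha|_{U_i}\in G_i$ for each $1\le i\le k$.
   Context: Structures have finite or countably infinite domain. Orbits of $\Gamma$ are the orbits of $\mathrm{Aut}(\Gamma)$ on elements. The orbit of an $n$-element subset $S$ is $\{\alpha(S)\mid\alpha\in\mathrm{Aut}(\Gamma)\}$; $\Gamma$ is sub-exponential unless there is $c>1$ such that for all sufficiently large $n$ the number of orbits of $n$-subsets is at least $c^n$. *)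

(* Defs.v *)
From HB Require Import structures.
From mathcomp Require Import all_boot all_order all_algebra.
From mathcomp Require Import all_classical all_reals.

Set Implicit Arguments.
Unset Strict Implicit.
Unset Printing Implicit Defensive.

Import Order.TTheory GRing.Theory Num.Theory.
Local Open Scope classical_set_scope.
Local Open Scope card_scope.
Local Open Scope ring_scope.

(* The signature is arbitrary (possibly infinite). *)
Record relStructure (D : Type) := RelStructure {
  rel_sym : Type;
  arity : rel_sym -> nat;
  interp : forall s : rel_sym, (arity s).-tuple D -> Prop
}.

Definition Aut (D : Type) (Gamma : relStructure D) : set (D -> D) :=
  [set a | bijective a /\
    forall (s : rel_sym Gamma) (t : (arity s).-tuple D),
      interp t <-> interp (map_tuple a t)].

Definition orbit_of (D : Type) (Gamma : relStructure D) (x : D) : set D :=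
  [set a x | a in Aut Gamma].

Definition orbits (D : Type) (Gamma : relStructure D) : set (set D) :=
  range (orbit_of Gamma).

Definition set_orbit_of (D : Type) (Gamma : relStructure D) (S : set D) :
    set (set D) :=
  [set a @` S | a in Aut Gamma].

Definition subset_orbits (D : Type) (Gamma : relStructure D) (n : nat) :
    set (set (set D)) :=
  [set set_orbit_of Gamma S | S in [set S : set D | S #= `I_n]].

(* The cardinality of A is at least the real r; true of every infinite A. *)
Definition card_ge_real (R : realType) (T : Type) (A : set T) (r : R) : Prop :=
  exists m : nat, r <= m%:R /\ `I_m #<= A.

Definition subexponential (R : realType) (D : Type) (Gamma : relStructure D) :
    Prop :=
  ~ exists c : R, 1 < c /\
      exists N : nat, forall n : nat, (N <= n)%N ->
        card_ge_real (subset_orbits Gamma n) (c ^+ n).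

(* The map a of D sends U to itself and its restriction to U is b. *)
Definition restricts_to (D : Type) (U : set D) (a : D -> D) (b : U -> U) :
    Prop :=
  forall x : U, a (\val x) = \val (b x).

Definition constituent (D : Type) (Gamma : relStructure D) (U : set D) :
    set (U -> U) :=
  [set b | exists2 a, Aut Gamma a & restricts_to a b].

Arguments constituent {D} Gamma U _.

(* Isomorphism of permutation groups: conjugacy by a bijection of the
   underlying sets, which is stronger than isomorphism of abstract groups. *)
Definition perm_group_iso (X Y : Type) (G : set (X -> X)) (H : set (Y -> Y)) :
    Prop :=
  exists (f : X -> Y) (g : Y -> X),
    [/\ cancel f g, cancel g f & H = [set f \o b \o g | b in G]].

Definition rat_lt : relStructure rat :=
  @RelStructure rat unit (fun=> 2%N)
    (fun _ t => tnth t ord0 < tnth t ord_max).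

(* Main.v *)
(* Every orbit carries an invariant linear order isomorphic to Q, so if G is
   transitive on the finite subsets of each given shape (number of points in
   each orbit), then any permutation acting correctly on each orbit agrees with
   an element of G on every finite set, hence preserves all relations.
   Otherwise take a smallest set s whose shape is bad. If s has two points in
   one orbit, then over the remaining points F the stabiliser of F is
   transitive on m-subsets of that orbit, m > 0, but not on (m+1)-subsets; an
   m-set then extends at its upper end in two inequivalent ways, and iterating
   gives 2^N inequivalent sets. If s meets each orbit at most once, then its
   points x, y and F yield an invariant relation between the orbits of x and y,
   whose fibres in the orbit of x are neither empty nor full. Either a fibre and
   its complement are both cofinal, and words are coded by increasing sequences
   in the orbit of x, or one of them is bounded above and generates a proper
   initial segment; the resulting cuts interleave the orbits of x and y and
   again code all words. *)
Require Import Defs.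
From mathcomp Require Import all_boot all_order all_algebra.
From mathcomp Require Import all_classical all_reals zify.

Set Implicit Arguments.
Unset Strict Implicit.
Unset Printing Implicit Defensive.

Import Order.TTheory GRing.Theory Num.Theory.
Local Open Scope classical_set_scope.
Local Open Scope card_scope.

(** * Groups acting on a coloured linear order, and words coded by finite sets *)

Section ColouredOrder.
Local Open Scope order_scope.
Context (disp : Order.disp_t) (X : orderType disp) (C : eqType) (c : X -> C).
Context (G : set (X -> X)).

(** The 2^n words of length n give pairwise inequivalent sets of n + p points. Inclusion suffices,
    as sizes agree and group elements are injective. *)
Definition exponential : Prop := exists p (S : seq bool -> seq X),
  (forall w, uniq (S w) /\ size (S w) = (size w + p)%N) /\
  forall g w w', G g -> size w = size w' ->
    {subset map g (S w) <= S w'} -> w = w'.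

Definition stab (F : seq X) : set (X -> X) :=
  [set g | G g /\ {in F, forall x, g x = x}].

(** Points of different colours are not compared: the order between colours is only auxiliary. *)
Definition coloured_homo (s : seq X) (h : X -> X) : Prop :=
  {in s, forall x, c (h x) = c x} /\
  {in s &, forall x y, c x = c y -> x < y -> h x < h y}.

Hypothesis G1 : G id.
Hypothesis GM : forall g h, G g -> G h -> G (g \o h).
Hypothesis GV : forall g, G g -> exists2 h, G h & cancel g h /\ cancel h g.
Hypothesis Gc : forall g, G g -> forall x, c (g x) = c x.
Hypothesis Glt : forall g, G g -> {homo g : x y / x < y}.

Lemma stabM F g h : stab F g -> stab F h -> stab F (g \o h).
Proof.
move=> [Gg Fg] [Gh Fh]; split; first exact: GM.
by move=> x xF /=; rewrite Fh // Fg.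
Qed.

Lemma stabV F g : stab F g -> exists2 h, stab F h & cancel g h /\ cancel h g.
Proof.
move=> [Gg Fg]; have [h Gh [gK hK]] := GV Gg; exists h => //; split=> // x xF.
by rewrite -{1}(Fg x xF) gK.
Qed.

(** [map g] turns the increasing enumeration of [F] into an increasing list of the same elements,
    and only one such list exists. *)
Lemma fix_of_subset F g : G g -> uniq F -> {subset map g F <= F} ->
  {in F, forall x, g x = x}.
Proof.
move=> Gg uF sub.
have inj_g : injective g by case: (GV Gg) => h _ [gK _]; exact: can_inj gK.
have e : map g (sort <=%O F) = sort <=%O F.
  apply: (irr_sorted_eq lt_trans (@ltxx _ X)).
  - by apply: homo_sorted (Glt Gg) _ _; rewrite sort_lt_sorted.
  - by rewrite sort_lt_sorted.
  have [||_ e] := @uniq_min_size _ (map g F) F _ sub _.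
  - by rewrite map_inj_uniq.
  - by rewrite size_map.
  move=> x; rewrite mem_sort -e.
  by apply/mapP/mapP => -[z zF ->]; exists z => //; rewrite mem_sort in zF *.
move=> x xF; have xs : x \in sort <=%O F by rewrite mem_sort.
move: (xs); rewrite -index_mem => lt.
have /(congr1 (fun s => nth x s (index x (sort <=%O F)))) := e.
by rewrite (nth_map x) // nth_index.
Qed.

(** The coding sets are [F ++ L w]. Colours keep the two pieces apart, so an element between two
    such sets fixes [F] pointwise; it then preserves [prec], and uniqueness of sorted enumerations
    makes it match the lists entry by entry. *)
Lemma exponentialI F m (L : seq bool -> seq X) (prec : rel X) :
  uniq F -> irreflexive prec -> transitive prec ->
  (forall g, stab F g -> {homo g : p q / prec p q}) ->
  (forall w, sorted prec (L w)) ->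
  (forall w, size (L w) = (size w + m)%N) ->
  (forall w z, z \in L w -> c z \notin map c F) ->
  (forall g w w', stab F g -> size w = size w' -> map g (L w) = L w' ->
    w = w') ->
  exponential.
Proof.
move=> uF irr tr homo_p sorted_L size_L colL inj_L.
have FL w z : z \in F -> z \in L w -> False.
  by move=> zF /colL/negP; apply; apply: map_f.
exists (m + size F)%N, (fun w => F ++ L w); split=> [w|g w w' Gg sz sub].
  rewrite cat_uniq uF (sorted_uniq tr irr) // andbT size_cat size_L addnC addnA.
  by split=> //; apply/hasPn => z /colL; apply: contra => zF; apply: map_f.
have inj_g : injective g by case: (GV Gg) => h _ [gK _]; exact: can_inj gK.
have subF : {subset map g F <= F}.
  move=> _ /mapP[x xF ->].
  have : g x \in F ++ L w' by apply/sub/map_f; rewrite mem_cat xF.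
  rewrite mem_cat => /orP[//|/colL]; rewrite Gc // => /negP[].
  exact: map_f.
have Hg : stab F g by split=> //; exact: fix_of_subset.
apply: (inj_L g) => //.
apply: (irr_sorted_eq tr irr) => //; first exact: homo_sorted (homo_p _ Hg) _ _.
have subL : {subset map g (L w) <= L w'}.
  move=> _ /mapP[x xL ->].
  have : g x \in F ++ L w' by apply/sub/map_f; rewrite mem_cat xL orbT.
  rewrite mem_cat => /orP[gxF|//].
  by case/negP: (colL _ _ xL); rewrite -(Gc Gg); apply: map_f.
have [||_ e] // := @uniq_min_size _ (map g (L w)) (L w') _ subL.
- by rewrite map_inj_uniq // (sorted_uniq tr irr).
- by rewrite size_map !size_L sz.
Qed.

(* Points are added on top one at a time; each new point realises the next
   letter of the word as the truth value of an invariant predicate. *)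
Lemma tree_exponential F i A (P : seq X -> Prop) :
  uniq F -> i \notin map c F -> sorted >%O A -> {in A, forall z, c z = i} ->
  (forall g s, stab F g -> P s -> P (map g s)) ->
  (forall (b : bool) s, sorted >%O s -> {in s, forall z, c z = i} ->
    (size A <= size s)%N ->
    exists z, [/\ c z = i, path >%O z s & P (z :: s) <-> b]) ->
  exponential.
Proof.
move=> uF iF sA cA invP step.
have /choice[e He] : forall bs : bool * seq X, exists z,
    sorted >%O bs.2 -> {in bs.2, forall z, c z = i} ->
    (size A <= size bs.2)%N ->
    [/\ c z = i, path >%O z bs.2 & P (z :: bs.2) <-> bs.1].
  move=> [b s]; have [[h1 h2 h3]|nh] := pselect
    [/\ sorted >%O s, {in s, forall z, c z = i} & (size A <= size s)%N].
    by have [z hz] := step b s h1 h2 h3; exists z.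
  (* For a bad [s] any value will do; extending [A] provides one. *)
  have [z _] := step b A sA cA (leqnn _).
  by exists z => h1 h2 h3; case: nh.
pose L := fix L w := if w is b :: w' then e (b, L w') :: L w' else A.
have LP w : [/\ sorted >%O (L w), {in L w, forall z, c z = i} &
    size (L w) = (size w + size A)%N].
  elim: w => [//|b w [s1 s2 s3]] /=.
  have [|/= h1 h2 _] := He (b, L w) s1 s2; first by rewrite s3 leq_addl.
  split=> //; last by rewrite s3.
  by move=> z; rewrite inE => /orP[/eqP -> //|]; apply: s2.
apply: (@exponentialI F (size A) L >%O) => //.
- by move=> x; rewrite /= ltxx.
- by move=> y x z /= xy yz; apply: lt_trans yz xy.
- by move=> g [Gg _] x y /= xy; apply: Glt.
- by move=> w; case: (LP w).
- by move=> w; case: (LP w).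
- by move=> w z; case: (LP w) => _ cL _ /cL ->.
move=> g w w' Hg; elim: w w' => [|b w IH] [|b' w'] //= [sz] [ez eL].
have [h Hh [gK hK]] := stabV Hg.
rewrite (IH w') //; congr (_ :: _).
(* [P] recovers the head letter from the list; [g] and its inverse carry this truth value across. *)
have PL v d : P (e (d, L v) :: L v) <-> d.
  have [s1 s2 s3] := LP v.
  by have [|_ _] := He (d, L v) s1 s2; first by rewrite s3 leq_addl.
apply/idP/idP => [/(PL w)/(invP g _ Hg)|/(PL w')/(invP h _ Hh)] /=.
  by rewrite ez eL => /PL.
by rewrite -ez -eL gK (mapK gK) => /PL.
Qed.

(* The bounds make the cuts defined by points of colour [j] interleave with
   points of colour [i]: x_0, y_0, x_1, y_1, ... is increasing for inclusion
   of initial segments, and a word picks one of x_n, y_n for each n. *)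
Lemma cut_exponential F i j (Q : X -> X -> Prop) (x0 : X) :
  uniq F -> i \notin map c F -> j \notin map c F -> i != j -> c x0 = i ->
  (forall x, exists2 y, x < y & c y = c x) ->
  (forall g z y, stab F g -> Q z y -> Q (g z) (g y)) ->
  (forall y, c y = j ->
    exists2 u, c u = i & forall z, c z = i -> Q z y -> z <= u) ->
  (forall z, c z = i -> exists2 y, c y = j & Q z y) ->
  exponential.
Proof.
move=> uF iF jF ij cx0 unb invQ bound cover.
(* An initial segment of colour [i]: the points up to [p], or the downward closure of the [Q]-fibre
   of [p]. *)
pose I p := [set z | c z = i /\
  if c p == i then is_true (z <= p)
  else exists z', [/\ c z' = i, z <= z' & Q z' p]].
have IS g p z : stab F g -> I p z -> I (g p) (g z).
  move=> Hg; have Gg := Hg.1; rewrite /I /= !Gc // => -[cz h]; split=> //.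
  have hle x y : x <= y -> g x <= g y.
    by rewrite le_eqVlt => /orP[/eqP -> //|/(Glt Gg)/ltW].
  case: ifP h => _; first exact: hle.
  by move=> [z' [cz' zz' qz']]; exists (g z'); rewrite Gc //; split; auto.
have IE g p z : stab F g -> I (g p) z -> exists2 z', I p z' & z = g z'.
  move=> Hg Iz; have [h Hh [gK hK]] := stabV Hg.
  by exists (h z); rewrite ?hK // -(gK p); apply: IS.
(* Inclusion is reversed because lists grow by larger cuts at the head. *)
pose prec p q := `[< I q `<` I p >].
have /choice[U HU] : forall y, exists u,
    c y = j -> c u = i /\ forall z, c z = i -> Q z y -> z < u.
  move=> y; have [cy|ny] := pselect (c y = j); last by exists x0.
  have [u cu hu] := bound y cy; have [u' uu' cu'] := unb u.
  exists u' => _; split; first by rewrite cu'.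
  by move=> z cz /(hu _ cz) zu; apply: le_lt_trans uu'.
have /choice[Y HY] : forall z, exists y, c z = i -> c y = j /\ Q z y.
  move=> z; have [cz|nz] := pselect (c z = i); last by exists x0.
  by have [y cy qy] := cover z cz; exists y.
(* [Y] gives x_n a partner whose fibre contains it, and [U] a point strictly above that whole
   fibre. *)
pose xs n := iter n (U \o Y) x0.
have cxs n : c (xs n) = i.
  by elim: n => [//|n IH] /=; case: (HU (Y (xs n))) => //; case: (HY _ IH).
pose pt n (b : bool) := if b then xs n else Y (xs n).
have cpt n b : c (pt n b) = if b then i else j.
  by case: b => /=; rewrite ?cxs //; case: (HY _ (cxs n)).
have cYi n : (c (Y (xs n)) == i) = false.
  by have := cpt n false; rewrite /= => ->; rewrite eq_sym (negPf ij).
have xy n : I (xs n) `<=` I (Y (xs n)).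
  move=> z [cz]; rewrite cxs eqxx => zx; split=> //; rewrite cYi.
  by exists (xs n); rewrite cxs; split=> //; case: (HY _ (cxs n)).
have yx n : I (Y (xs n)) `<` I (xs n.+1).
  have [cY _] := HY _ (cxs n); have [cU hU] := HU _ cY; split.
    move=> z [cz]; rewrite cYi => -[z' [cz' zz' qz']]; split=> //.
    by rewrite cxs eqxx /=; apply: ltW; apply: le_lt_trans zz' (hU _ _ _).
  move=> /(_ (xs n.+1)) []; first by split; rewrite cxs ?eqxx.
  move=> _; rewrite cYi => -[z' [cz' zz' qz']].
  by have := lt_le_trans (hU _ cz' qz') zz'; rewrite ltxx.
have strict n b b' : I (pt n b) `<` I (pt n.+1 b').
  have s1 : I (pt n b) `<=` I (Y (xs n)) by case: b => //=; apply: xy.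
  have s2 : I (xs n.+1) `<=` I (pt n.+1 b') by case: b' => //; apply: xy.
  have [s3 s4] := yx n; split; first by move=> z /s1/s3/s2.
  by move=> s5; apply: s4 => z /s2/s5/s1.
pose L := fix L w := if w is b :: w' then pt (size w') b :: L w' else [::].
apply: (@exponentialI F 0 L prec) => //.
- by move=> p; apply/asboolP => -[].
- move=> q p r /asboolP[a1 a2] /asboolP[b1 b2]; apply/asboolP.
  by split=> [z /b1/a1 //|pr]; apply: a2 => z /pr/b1.
- move=> g Hg p q /asboolP[a1 a2]; apply/asboolP; split.
    by move=> z /(IE _ _ _ Hg)[z' /a1 Iz' ->]; apply: IS.
  move=> sub; apply: a2 => z /(IS _ _ _ Hg)/sub/(IE _ _ _ Hg)[z' Iz'].
  by have [h _ [gK _]] := stabV Hg => /(can_inj gK) ->.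
- elim=> [//|b [//|b' w]] /= IH; rewrite IH andbT; apply/asboolP; exact: strict.
- by elim=> [//|b w] /= ->; rewrite !addn0.
- elim=> [//|b w IH] z; rewrite /= inE => /orP[/eqP ->|/IH //].
  by rewrite cpt; case: b.
move=> g w w' Hg; elim: w w' => [|b w IH] [|b' w'] //= [sz] [ez eL].
rewrite (IH w') //; congr (_ :: _).
(* The letter is read off the colour of the head, which [g] preserves. *)
have := congr1 c (ez : g (pt (size w) b) = pt (size w') b').
rewrite (Gc Hg.1) !cpt.
by case: b b' {ez} => -[] // e; move: ij; rewrite e eqxx.
Qed.


(** * Extending finite order-preserving maps to group elements *)

Hypothesis Gtr : forall x y, c x = c y -> exists2 g, G g & g x = y.
Hypothesis unb : forall x, exists2 y, x < y & c y = c x.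

(** As [h] varies, this is transitivity of [G] on the sets of the shape of [s]. *)
Definition extendable (s : seq X) : Prop :=
  forall h, coloured_homo s h -> exists2 g, G g & {in s, g =1 h}.

Lemma extendable_perm s t : s =i t -> extendable s -> extendable t.
Proof.
move=> st es h [h1 h2]; have [|g Gg gh] := es h.
  by split=> [x|x y]; rewrite !st; [exact: h1|exact: h2].
by exists g => // x; rewrite -st; apply: gh.
Qed.

(** Undoing [h] on [s] by the inverse of an element that agrees with it there leaves a map that
    fixes [s] and moves at most [x]. *)
Lemma extendable_cons x s :
  extendable s ->
  (forall x', c x' = c x ->
    {in s, forall z, c z = c x -> (z < x -> z < x') /\ (x < z -> x' < z)} ->
    exists2 g, stab s g & g x = x') ->
  extendable (x :: s).
Proof.
move=> es ext h [h1 h2]; have [|g Gg gh] := es h.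
  split=> [z zs|z t zs ts]; first by apply: h1; rewrite inE zs orbT.
  by apply: h2; rewrite inE (zs, ts) orbT.
have [g' Gg' [gK g'K]] := GV Gg.
have [||k [Gk ks] kx] := ext (g' (h x)).
- by rewrite Gc // h1 // mem_head.
- move=> z zs cz; rewrite -{2 4}(gK z) gh //.
  by split=> zx; apply: Glt => //; apply: h2; rewrite ?inE ?zs ?eqxx ?orbT.
exists (g \o k); first exact: GM.
by move=> z; rewrite inE => /orP[/eqP ->|zs] /=; rewrite ?kx ?g'K // ks ?gh.
Qed.

(* Subexponential growth forces, over any fixed [F], transitivity on
   [m]-subsets of one orbit to propagate from [m > 0] to [m + 1]. *)
Lemma extendable_repeated_colour F A x :
  ~ exponential -> uniq F -> c x \notin map c F -> A != [::] ->
  sorted >%O (x :: A) -> {in A, forall z, c z = c x} ->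
  extendable (A ++ F) -> extendable (x :: A ++ F).
Proof.
move=> nexp uF xF A0 sxA cA eAF; apply: extendable_cons => // x' cx' ordx'.
apply: contrapT => nog; apply: nexp.
have sA : sorted >%O A by apply: path_sorted sxA.
have trgt : transitive (>%O : rel X).
  by move=> b a d ab bd; apply: lt_trans bd ab.
have irgt : irreflexive (>%O : rel X) by move=> b; rewrite /= ltxx.
have uA : uniq A by apply: sorted_uniq sA.
have xA : {in A, forall z, z < x}.
  by move=> z zA; have /allP := order_path_min trgt sxA; apply.
have x'A : {in A, forall z, z < x'}.
  move=> z zA; have [|h _] := ordx' z _ (cA z zA); first by rewrite mem_cat zA.
  exact/h/xA.
have FA z : z \in F -> c z == c x = false.
  by move=> zF; apply: contraNF xF => /eqP <-; apply: map_f.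
pose Red s z := exists g, [/\ stab F g, map g A = s & g x = z].
(* A new point is judged only against the [size A] highest points below it, a copy of [A]. *)
apply: (@tree_exponential F (c x) A
  (fun s => if s is z :: s' then Red (take (size A) s') z else False)) => //.
  move=> g [//|z s] Hg [k [Hk kA kx]].
  exists (g \o k); split; first exact: stabM.
    by rewrite map_comp kA map_take.
  by rewrite /= kx.
move=> b s ss cs szs.
have sz : size (take (size A) s) = size A by rewrite size_takel.
have [|g Gg gh] := eAF (fun z => if c z == c x
    then nth x (take (size A) s) (index z A) else z).
  split=> [z|z t]; rewrite !mem_cat.
    case/orP => [zA|/FA -> //]; rewrite /= (cA z zA) eqxx cs //.
    by apply: (mem_take (n0 := size A)); rewrite mem_nth // sz index_mem.
  move=> zAF tAF czt zt; rewrite -czt.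
  case/orP: zAF => [zA|zF]; last by rewrite FA.
  rewrite (cA z zA) eqxx.
  have tA : t \in A.
    by case/orP: tAF => // /FA; rewrite -czt cA // eqxx.
  have lt_index : (index t A < index z A)%N.
    rewrite ltnNge leq_eqVlt; apply/negP => /orP[/eqP e|lt].
      by move: zt; rewrite -(nth_index x zA) e nth_index // ltxx.
    have /= := sorted_ltn_nth trgt x sA (index z A) (index t A).
    rewrite !inE !index_mem zA tA !nth_index // => /(_ isT isT lt) tz.
    by have := lt_trans zt tz; rewrite ltxx.
  have /= := sorted_ltn_nth trgt x (take_sorted (size A) ss)
    (index t A) (index z A).
  by rewrite !inE sz !index_mem zA tA; apply.
have Hg : stab F g.
  by split=> // z zF; rewrite gh ?mem_cat ?zF ?orbT //= FA.
have gA : map g A = take (size A) s.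
  apply: (@eq_from_nth _ x); first by rewrite size_map sz.
  move=> n; rewrite size_map => nA.
  rewrite (nth_map x) // gh ?mem_cat ?mem_nth //.
  by rewrite cA ?mem_nth // eqxx index_uniq.
have gtop z : c z = c x -> {in A, forall t, t < z} -> path >%O (g z) s.
  move=> cz zA; rewrite path_sortedE // ss andbT.
  have top : {in take (size A) s, forall t, t < g z}.
    by move=> t; rewrite -gA => /mapP[t' t'A ->]; apply: Glt => //; apply: zA.
  (* Since [A] is non-empty, the maximum [a] of [s] lies in the image of [A], hence below [g z]. *)
  case: s A0 ss top {szs cs sz gh gA} => [//|a s] A0 ss top.
  have ga : a < g z by apply: top; case: (A) A0 => // *; rewrite mem_head.
  apply/allP => t; rewrite inE => /orP[/eqP -> //|ts]; apply: lt_trans ga.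
  by have /allP := order_path_min trgt ss; apply.
(* [g x] realises true. If [g x'] did too, an element fixing [A] and [F] would send [x] to [x']. *)
case: b; [exists (g x)|exists (g x')]; split; rewrite ?Gc //; try exact: gtop.
  by split=> // _; exists g.
split=> // -[k [Hk kA kx]]; case: nog.
have [h Hh [gK hK]] := stabV Hg; exists (h \o k); last by rewrite /= kx gK.
have Hhk : stab F (h \o k) by apply: stabM.
split; first exact: Hhk.1.
move=> z; rewrite mem_cat => /orP[zA|]; last exact: Hhk.2.
have /(congr1 (map h)) : map k A = map g A by rewrite kA gA.
rewrite (mapK gK) -map_comp => e.
have /(congr1 (fun s => nth x s (index z A))) := e.
by rewrite (nth_map x) ?index_mem // nth_index.
Qed.

(** If extension fails, consider the orbit of [(x, y)] under the stabiliser of [F]. When its fibre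
    over [y] and the complement are both cofinal in the colour of [x], increasing sequences code
    words; otherwise the bounded one yields cuts. *)
Lemma extendable_distinct_colours F x y :
  ~ exponential -> uniq (map c (x :: y :: F)) ->
  extendable (x :: F) -> extendable (y :: F) -> extendable (x :: y :: F).
Proof.
move=> nexp /= /andP[]; rewrite inE negb_or => /andP[xy xF] /andP[yF ucF] ex ey.
have uF : uniq F := map_uniq ucF.
have trans z : extendable (z :: F) -> c z \notin map c F ->
    forall u, c u = c z -> exists2 g, stab F g & g z = u.
  move=> ez zF u cu.
  have NzF t : t \in F -> (t == z) = false.
    by move=> tF; apply: contraNF zF => /eqP <-; apply: map_f.
  have [|g Gg gh] := ez (fun t => if t == z then u else t).
    split=> [t|t t'].
      by rewrite inE; case: eqP => [->//|_].
    rewrite !inE; case: eqP => [->|_] /=; case: eqP => [->|_] //=.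
    - by rewrite ltxx.
    - by move=> _ t'F ctt; case/negP: zF; rewrite ctt map_f.
    - by move=> tF _ ctt; case/negP: zF; rewrite -ctt map_f.
  exists g; last by rewrite gh ?mem_head // eqxx.
  by split=> // t tF; rewrite gh ?inE ?tF ?orbT // NzF.
have {trans} [transx transy] := (trans x ex xF, trans y ey yF).
apply: extendable_cons => // x' cx' _; apply: contrapT => nog; apply: nexp.
pose Red z t := exists g, [/\ stab F g, g x = z & g y = t].
have RedS g z t : stab F g -> Red z t -> Red (g z) (g t).
  move=> Hg [k [Hk <- <-]]; exists (g \o k); split=> //; exact: stabM.
have RedE g z t : stab F g -> Red (g z) (g t) <-> Red z t.
  move=> Hg; split; last exact: RedS.
  by have [h Hh [gK _]] := stabV Hg => /(RedS _ _ _ Hh); rewrite !gK.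
have Redxy : Red x y by exists id.
have NRedx'y : ~ Red x' y.
  move=> [k [[Gk kF] kx ky]]; apply: nog; exists k => //; split=> // t.
  by rewrite inE => /orP[/eqP ->|/kF].
have wit (b : bool) : exists z, c z = c x /\ (Red z y <-> b).
  by case: b; [exists x|exists x'].
have [both|] := pselect (forall (b : bool) u, c u = c x ->
    exists z, [/\ c z = c x, u < z & Red z y <-> b]).
  apply: (@tree_exponential (y :: F) (c x) [::]
    (fun s => if s is z :: _ then Red z y else False)) => //.
  - by rewrite /= uF andbT; apply: contra yF; apply: map_f.
  - by rewrite /= inE negb_or xy.
  - move=> g [//|z s] [Gg gF] /=.
    have gy : g y = y by apply: gF; rewrite mem_head.
    rewrite -{2}gy; apply: RedS; split=> // t tF; apply: gF.
    by rewrite inE tF orbT.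
  move=> b [|u s] ss cs _.
    by have [z [cz Rz]] := wit b; exists z.
  have [|z [cz uz Rz]] := both b u; first by apply: cs; rewrite mem_head.
  by exists z; split=> //=; rewrite uz.
move=> /existsNP[b /existsNP[u /not_implyP[cu nob]]].
have bound z : c z = c x -> (Red z y <-> b) -> z <= u.
  by move=> cz Rz; rewrite leNgt; apply/negP => uz; apply: nob; exists z.
apply: (@cut_exponential F (c x) (c y) (fun z t => Red z t <-> b) x) => //.
- by move=> g z t Hg Rz; rewrite RedE.
(* An element moving [y] to [t] transports the bound over [y] to the fibre over [t]. *)
- move=> t /transy[k Hk <-]; exists (k u); first by rewrite Gc //; case: Hk.
  move=> z cz; have [k' Hk' [kK k'K]] := stabV Hk.
  rewrite -(k'K z) RedE // => Rz.
  have := bound _ (etrans (Gc Hk'.1 z) cz) Rz.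
  by rewrite le_eqVlt => /orP[/eqP -> //|/(Glt Hk.1)/ltW].
(* A point with truth value [b] over [y] is moved to [z], and [y] moves along with it. *)
- move=> z cz; have [x1 [cx1 Rx1]] := wit b.
  have [k1 Hk1 k1x] := transx x1 cx1; have [k Hk kx] := transx z cz.
  have [k1' Hk1' [k1K k1'K]] := stabV Hk1.
  have H : stab F (k \o k1') by apply: stabM.
  exists (k (k1' y)); first by rewrite (Gc Hk.1) (Gc Hk1'.1).
  by rewrite -kx -(k1K x) k1x; apply: iff_trans Rx1; apply: (RedE _ _ _ H).
Qed.

(** Induction on the number of distinct points: a repeated colour is listed in decreasing order and
    its top point removed; with distinct colours, any two points can be split off. *)
Lemma all_extendable s : ~ exponential -> extendable s.
Proof.
move=> nexp; apply: (@extendable_perm (undup s)); first exact: mem_undup.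
move: (undup s) (undup_uniq s) => {}s.
have [n] := ubnP (size s); elim: n s => // n IH s; rewrite ltnS => szs us.
(* [Some] makes [None] available as the default that [uniqPn] requires. *)
have [ucs|/(uniqPn None)] := boolP (uniq (map (Some \o c) s)).
  have {ucs}: uniq (map c s) by move: ucs; rewrite map_comp => /map_uniq.
  case: s us szs => [|x [|y F]] us szs ucs.
  - by move=> h _; exists id.
  - apply: extendable_cons; first by move=> h _; exists id.
    by move=> x' cx' _; have [g Gg gx] := Gtr (esym cx'); exists g.
  - move: us; rewrite /= inE negb_or => /and3P[/andP[_ xF] yF uF].
    apply: extendable_distinct_colours => //.
      by apply: IH => //=; rewrite xF.
    by apply: IH => //=; rewrite yF.
move=> [k [l]]; rewrite size_map => -[kl ls].
case: s us szs ls => // x0 s' us szs ls; set s := x0 :: s' in us szs ls *.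
have ks := ltn_trans kl ls.
rewrite !(nth_map x0) // => -[ckl].
set i := c (nth x0 s k) in ckl.
pose T := rev (sort <=%O [seq z <- s | c z == i]).
pose F := [seq z <- s | c z != i].
have memT z : (z \in T) = (c z == i) && (z \in s).
  by rewrite mem_rev mem_sort mem_filter.
have sT : sorted >%O T.
  by rewrite rev_sorted sort_lt_sorted filter_uniq.
have szTF : size T + size F = size s.
  by rewrite size_rev size_sort !size_filter count_predC.
have kT : nth x0 s k \in T by rewrite memT eqxx mem_nth.
have lT : nth x0 s l \in T by rewrite memT -ckl eqxx mem_nth.
have kl_neq : nth x0 s k != nth x0 s l by rewrite nth_uniq // ltn_eqF.
move: T memT sT szTF kT lT => [//|x A] memT sT szTF kT lT.
have cxi : c x = i by have := mem_head x A; rewrite memT => /andP[/eqP].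
apply: (@extendable_perm (x :: A ++ F)).
  move=> z; rewrite -cat_cons mem_cat memT mem_filter.
  by case: (c z == i); rewrite /= ?orbF.
apply: extendable_repeated_colour => //.
- by rewrite filter_uniq.
- rewrite cxi; apply/mapP => -[z].
  by rewrite mem_filter => /andP[/eqP cz _] /esym.
- apply/eqP => A0; move: kT lT kl_neq; rewrite A0 !inE => /eqP -> /eqP ->.
  by rewrite eqxx.
- move=> z zA; have : z \in x :: A by rewrite inE zA orbT.
  by rewrite memT cxi => /andP[/eqP].
apply: IH; first by rewrite size_cat; apply: leq_trans szs; rewrite -szTF.
have uT : uniq (x :: A).
  by apply: sorted_uniq sT => [b a d ab bd|a];
    [exact: lt_trans bd ab|exact: ltxx].
move: uT; rewrite cons_uniq => /andP[_ uA].
rewrite cat_uniq uA filter_uniq // andbT.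
apply/hasPn => z; rewrite mem_filter => /andP[cz _]; apply: contra cz => zA.
have : z \in x :: A by rewrite inE zA orbT.
by rewrite memT => /andP[].
Qed.

End ColouredOrder.

(** * Counting finite sets *)

Lemma card_image_seq (T : eqType) (U : Type) (f : T -> U) (s : seq T) :
  injective f -> uniq s -> f @` [set` s] #= `I_(size s).
Proof.
move=> inj_f us.
have cs : [set` s] #= `I_(size s).
  case: s us => [_|x s us]; first by rewrite II0 set_nil card_eq00.
  have -> : [set` x :: s] = nth x (x :: s) @` `I_(size (x :: s)).
    apply/seteqP; split=> [z /= zs|_ [n /= ns <-]]; last exact: mem_nth.
    by exists (index z (x :: s)); [rewrite /mkset index_mem|rewrite nth_index].
  apply: inj_card_eq => n m; rewrite !inE /= => ns ms /eqP.
  by rewrite nth_uniq // => /eqP.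
by apply: card_eq_trans cs; apply: inj_card_eq => x y _ _ /inj_f.
Qed.

Lemma card_le_finType_inj (T : finType) (U : Type) (A : set U) (f : T -> U) :
  injective f -> (forall x, A (f x)) -> `I_#|T| #<= A.
Proof.
move=> inj_f fA; have := @card_image_seq T U f (enum T) inj_f (enum_uniq T).
rewrite -cardT => /card_le_eql <-.
by apply: subset_card_le => _ [x _ <-].
Qed.

(** * The automorphism group and its orbits *)

Section Automorphisms.
Context (D : Type) (Gamma : relStructure D).

Lemma Aut_id : Aut Gamma id.
Proof.
split; first by exists id.
move=> s t; rewrite (_ : map_tuple id t = t) //.
by apply: val_inj; rewrite /= map_id.
Qed.

Lemma Aut_comp a b : Aut Gamma a -> Aut Gamma b -> Aut Gamma (a \o b).
Proof.
move=> [ba ia] [bb ib]; split; first exact: bij_comp.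
move=> s t; rewrite ib ia (_ : map_tuple a _ = map_tuple (a \o b) t) //.
by apply: val_inj; rewrite /= map_comp.
Qed.

Lemma Aut_inv a : Aut Gamma a ->
  exists2 b, Aut Gamma b & cancel a b /\ cancel b a.
Proof.
move=> [[b aK bK] ia]; exists b => //; split; first by exists a.
move=> s t; rewrite [X in _ <-> X]ia (_ : map_tuple a _ = t) //.
by apply: val_inj; rewrite /= mapK.
Qed.

Lemma orbit_of_eq x y :
  orbit_of Gamma x y -> orbit_of Gamma x = orbit_of Gamma y.
Proof.
move=> [a Ha <-]; have [a' Ha' [aK _]] := Aut_inv Ha.
apply/seteqP; split=> z [b Hb <-].
  by exists (b \o a'); rewrite /= ?aK //; apply: Aut_comp.
by exists (b \o a) => //; apply: Aut_comp.
Qed.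

Lemma orbit_of_refl x : orbit_of Gamma x x.
Proof. by exists id => //; exact: Aut_id. Qed.

End Automorphisms.

Lemma Aut_rat_lt_homo h : Aut rat_lt h -> {homo h : q r / (q < r)%R}.
Proof.
move=> [_ /(_ tt)] ih q r qr.
by have /ih : @interp _ rat_lt tt [tuple q; r] by [].
Qed.

(** * Rational coordinates on the orbits *)

Section Coordinates.
Context (D : Type) (Gamma : relStructure D) (k : nat) (U : 'I_k -> set D).
Hypothesis U_inj : injective U.
Hypothesis U_orbits : range U = orbits Gamma.
Hypothesis U_const : forall i,
  perm_group_iso (constituent Gamma (U i)) (Aut rat_lt).

Definition locally_aut (a : D -> D) : Prop := forall i,
  exists2 b : U i -> U i, constituent Gamma (U i) b & restricts_to a b.

Lemma Aut_locally_aut a : Aut Gamma a -> locally_aut a.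
Proof.
move=> Ha i.
have Ua x : U i x -> U i (a x).
  have : orbits Gamma (U i) by rewrite -U_orbits; exists i.
  move=> [z _ <-] [b Hb <-]; exists (a \o b) => //; exact: Aut_comp.
pose b (x : U i) : U i := SigSub (mem_set (Ua _ (set_valP x))).
by exists b => //; exists a.
Qed.

(** The given isomorphisms identify each orbit with [rat]; conjugation turns elements of the
    constituents into automorphisms of the rationals, which are increasing. *)
Lemma coordinates : exists (col : D -> 'I_k) (rk : D -> rat)
    (pt : 'I_k * rat -> D),
  [/\ cancel (fun x => (col x, rk x)) pt,
      cancel pt (fun x => (col x, rk x)),
      forall x y, col x = col y -> exists2 a, Aut Gamma a & a x = y &
      forall a, locally_aut a -> (forall x, col (a x) = col x) /\
        forall x y, col x = col y ->
          (rk x < rk y)%R -> (rk (a x) < rk (a y))%R].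
Proof.
have /choice[col colE] : forall x, exists i, U i = orbit_of Gamma x.
  move=> x; have : orbits Gamma (orbit_of Gamma x) by exists x.
  by rewrite -U_orbits => -[i _ <-]; exists i.
have UP i x : U i x <-> col x = i.
  split=> [Uix|<-]; last by rewrite colE; exact: orbit_of_refl.
  apply: U_inj; rewrite colE; move: Uix.
  have : orbits Gamma (U i) by rewrite -U_orbits; exists i.
  by move=> [z _ <-] zx; rewrite (orbit_of_eq zx).
have Ucol x : x \in U (col x) by apply/mem_set/UP.
pose f i := sval (cid (U_const i)).
have fP i : exists g, [/\ cancel (f i) g, cancel g (f i) &
    Aut rat_lt = [set f i \o b \o g | b in constituent Gamma (U i)]].
  exact: svalP (cid (U_const i)).
pose g i := sval (cid (fP i)).
have fgP i : [/\ cancel (f i) (g i), cancel (g i) (f i) &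
    Aut rat_lt = [set f i \o b \o g i | b in constituent Gamma (U i)]].
  exact: svalP (cid (fP i)).
pose rk x := f (col x) (SigSub (Ucol x)).
have rkE i (u : U i) : rk (\val u) = f i u.
  (* The colour of [\val u] is only provably equal to [i], so the index is generalised before the
     equation is eliminated. *)
  have E j (e : col (\val u) = j) (p : \val u \in U j) :
      rk (\val u) = f j (SigSub p).
    by case: j / e p => p; congr (f _ _); apply: val_inj.
  rewrite (E i _ (valP u)); last exact/UP/set_valP.
  by congr (f _ _); apply: val_inj.
have colE' i (u : U i) : col (\val u) = i by apply/UP/set_valP.
exists col, rk, (fun p => \val (g p.1 p.2)); split.
- by move=> x; have [fK _ _] := fgP (col x); rewrite /= /rk fK.
- by move=> [i q]; have [_ gK _] := fgP i; rewrite /= colE' rkE gK.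
- by move=> x y cxy; have : U (col x) y by [apply/UP]; rewrite colE.
move=> a Ha; have cola x : col (a x) = col x.
  have [b _ ab] := Ha (col x).
  by have := ab (SigSub (Ucol x)); rewrite /= => ->; rewrite colE'.
split=> // x y cxy; have [b Gb ab] := Ha (col x).
have Uy : y \in U (col x) by rewrite cxy.
have -> : x = \val (SigSub (Ucol x) : U (col x)) by [].
have -> : y = \val (SigSub Uy : U (col x)) by [].
rewrite !ab !rkE; set u := SigSub _; set v := SigSub _.
have [fK gK eA] := fgP (col x).
have /Aut_rat_lt_homo h : Aut rat_lt (f (col x) \o b \o g (col x)).
  by rewrite eA; exists b.
by move=> /h; rewrite /= !fK.
Qed.

End Coordinates.

(** * Exponential growth from inequivalent sets *)

Lemma exponential_growth (R : realType) (D : Type) (Gamma : relStructure D)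
    (p : nat) (S : seq bool -> set D) :
  (forall w, S w #= `I_(size w + p)) ->
  (forall a w w', Aut Gamma a -> size w = size w' -> a @` S w = S w' ->
    w = w') ->
  ~ subexponential R Gamma.
Proof.
move=> cardS inj_S; apply.
(* For n >= 2p and m = n - p, the 2^m words of length m suffice: 2m >= n gives 2^m >= (sqrt 2)^n. *)
exists (Num.sqrt 2%:R)%R; split.
  by rewrite -[X in (X < _)%R](@sqrtr1 R) ltr_sqrt ?ltr1n.
exists (2 * p)%N => n pn; pose m := (n - p)%N.
exists (2 ^ m)%N; split.
  have -> : ((2 ^ m)%:R = Num.sqrt 2%:R ^+ (2 * m) :> R)%R.
    by rewrite exprM sqr_sqrtr ?ler0n // natrX.
  apply: ler_weXn2l; last by rewrite /m; lia.
  by rewrite -[X in (X <= _)%R](@sqrtr1 R) ler_sqrt ?ler1n.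
rewrite -card_bool -card_tuple.
apply: (@card_le_finType_inj _ _ _
  (fun w : m.-tuple bool => set_orbit_of Gamma (S w))).
  move=> w w' eww'.
  have : set_orbit_of Gamma (S w') (S w').
    by exists id; [exact: Aut_id|rewrite image_id].
  rewrite -eww' => -[a Ha aS]; apply: val_inj; apply: (inj_S a) => //.
  by rewrite !size_tuple.
move=> w; exists (S w) => //=; have := cardS w.
by rewrite size_tuple subnK //; move: pn; lia.
Qed.

(** * Transfer to the lexicographic product of colours and rationals *)

Theorem theorem3p9 (R : realType) (D : Type) (D_countable : countable [set: D])
    (Gamma : relStructure D) (Gamma_subexp : subexponential R Gamma)
    (k : nat) (U : 'I_k -> set D)
    (U_inj : injective U) (U_orbits : range U = orbits Gamma)
    (U_const : forall i : 'I_k,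
      perm_group_iso (constituent Gamma (U i)) (Aut rat_lt))
    (alpha : D -> D) (alpha_perm : bijective alpha) :
  Aut Gamma alpha <->
  forall i : 'I_k,
    exists2 b : U i -> U i,
      constituent Gamma (U i) b & restricts_to alpha b.
Proof.
split; first exact: Aut_locally_aut.
move=> alpha_loc.
have [col [rk [pt [eK ptK col_trans loc]]]] :=
  coordinates U_inj U_orbits U_const.
(* Automorphisms fix the first coordinate, so the lexicographic order makes
   them increasing on the whole domain. *)
pose X : orderType _ := ('I_k *l rat)%type.
pose e (x : D) : X := (col x, rk x).
pose G : set (X -> X) := [set h | Aut Gamma (pt \o h \o e)].
have colpt p : col (pt p) = p.1 by rewrite -[in RHS](ptK p).
have rkpt p : rk (pt p) = p.2 by rewrite -[in RHS](ptK p).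
pose conj (a : D -> D) : X -> X := e \o a \o pt.
have conjG a : Aut Gamma a -> G (conj a).
  move=> Ha; rewrite /G /= (_ : _ \o e = a) //.
  by apply/funext => x; rewrite /conj /= eK eK.
have ltX (p q : X) :
    (p < q)%O = (p.1 <= q.1)%O && ((q.1 <= p.1)%O ==> (p.2 < q.2)%O).
  exact: Order.ProdLexiOrder.ltEprodlexi.
have locX a : locally_aut Gamma U a ->
    (forall p, (conj a p).1 = p.1) /\ {homo conj a : p q / (p < q)%O}.
  move=> /loc[ca ra].
  have cE p : (conj a p).1 = p.1 by rewrite /conj /= ca colpt.
  split=> // p q; rewrite !ltX !cE => /andP[pq /implyP h]; rewrite pq /=.
  apply/implyP => qp; apply: ra; last by rewrite !rkpt h.
  by rewrite !colpt; apply/eqP; rewrite eq_le pq.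
have G_loc h : G h -> (forall p, (h p).1 = p.1) /\ {homo h : p q / (p < q)%O}.
  move=> /Aut_locally_aut-/(_ _ _ U_orbits)/locX.
  rewrite (_ : conj _ = h) //; apply/funext => p.
  by rewrite /conj /= /e ptK ptK.
have nexp : ~ exponential G.
  move=> [p [S [S1 S2]]].
  apply: (@exponential_growth R D Gamma p (fun w => pt @` [set` S w])) => //.
    move=> w; have [uS <-] := S1 w.
    by apply: card_image_seq uS; exact: can_inj ptK.
  move=> a w w' Ha sww' aS; apply: (S2 (conj a)) => //; first exact: conjG.
  move=> _ /mapP[q qS ->].
  have : (a @` (pt @` [set` S w])) (a (pt q)) by exists (pt q) => //; exists q.
  by rewrite aS => -[q' q'S eq']; rewrite /conj /= -eq' /e ptK.
pose colX (p : X) : 'I_k := p.1.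
have ext s h : coloured_homo colX s h -> exists2 g, G g & {in s, g =1 h}.
  apply: (@all_extendable _ X _ colX G) => //.
  - rewrite /G /= (_ : _ \o e = id); first exact: Aut_id.
    by apply/funext => x /=; rewrite eK.
  - move=> g1 g2 Hg1 Hg2; rewrite /G /=.
    rewrite (_ : _ \o e = (pt \o g1 \o e) \o (pt \o g2 \o e)).
      exact: Aut_comp.
    by apply/funext => x; rewrite /= /e ptK.
  - move=> g /Aut_inv[b Hb [gb bg]]; exists (conj b); first exact: conjG.
    split=> p.
      have := gb (pt p); rewrite /= /e ptK => gb'.
      by rewrite /conj /= /e gb' ptK.
    have := bg (pt p); rewrite /= => bg'.
    by rewrite /conj /= -[LHS](ptK (g _)) bg' /e ptK.
  - by move=> g /G_loc[].
  - by move=> g /G_loc[].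
  - move=> p q pq.
    have [|a Ha apq] := col_trans (pt p) (pt q); first by rewrite !colpt.
    by exists (conj a); [exact: conjG|rewrite /conj /= apq /e ptK].
  - move=> [i q]; exists ((i, q + 1)%R : X) => //.
    by rewrite ltX /= lexx ltrDl ltr01.
split=> // s t.
(* A relation sees only the entries of [t], and there [alpha], read in coordinates, agrees with an
   element of [G]. *)
have [|g Gg gh] := ext [seq e x | x <- t] (conj alpha).
  have [cA hA] := locX _ alpha_loc.
  by split=> [x _|x y _ _ _]; [exact: cA|exact: hA].
rewrite (proj2 Gg s t) (_ : map_tuple _ t = map_tuple alpha t) //.
apply: val_inj => /=; elim: (tval t) gh => [//|x u IH] gh /=.
rewrite IH => [|p pu]; last by apply: gh; rewrite inE pu orbT.
by congr (_ :: _); rewrite gh ?mem_head // /conj /= /e !eK.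
Qed.
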